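(* Let $K$ be a field and let $\Delta$ be a quasi-forest on $[n]$ satisfying (i) each connected component of $\Delta$ is connected in codimension $1$; (ii) each face of codimension $1$ belongs to at most two facets. Then $\Delta$ is a forest if and only if the vertex cover algebra $A(\Delta)$ is standard graded.
   Context: $\mathbb{N}=\{0,1,2,\ldots\}$ and $[n]=\{1,\ldots,n\}$. A simplicial complex on $[n]$ is a collection of subsets of $[n]$ (faces) closed under taking subsets; its maximal faces are its facets, and $\mathcal{F}(\Delta)$ is the set of facets. Complexes have at least one facet and their facets are nonempty. A subcomplex of $\Delta$ means a simplicial complex all of whose facets are facets of $\Delta$. A facet $F$ of $\Delta$ is a leaf if either $F$ is the only facet of $\Delta$, or there exists $G\in\mathcal{F}(\Delta)$, $G\ne F$, such that $H\cap F\subseteq G\cap F$ for each $H\in\mathcal{F}(\Delta)$ with $H\ne F$. $\Delta$ is a forest if each subcomplex of $\Delta$ has a leaf. $\Delta$ is a quasi-forest if its facets can be ordered $F_1,\ldots,F_m$ such that $F_i$ is a leaf of the simplicial complex with facets $F_1,\ldots,F_i$ for $i=2,\ldots,m$. A connected simplicial complex $\Sigma$ is connected in codimension $1$ if for any two facets $G,H$ of $\Sigma$ there is a sequence of facets $G=G_0,G_1,\ldots,G_p=H$ of $\Sigma$ such that each $G_k\cap G_{k+1}$ is a face of codimension $1$, i.e. $|G_k\cap G_{k+1}|=|G_k|-1=|G_{k+1}|-1$ (in particular all facets of $\Sigma$ have the same cardinality). In (ii), codimension is taken within a connected component: a face of codimension $1$ of a component whose facets have cardinality $e$ is a face of that component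 of cardinality $e-1$, and the condition is that it belongs to at most two facets of that component. For $k\ge 0$, a vector $\mathbf{c}=(c_1,\ldots,c_n)\in\mathbb{N}^n$ is a $k$-cover of $\Delta$ if $\sum_{i\in F}c_i\ge k$ for all $F\in\mathcal{F}(\Delta)$. Let $S=K[x_1,\ldots,x_n]$, let $t$ be a new variable, and let $A_k(\Delta)$ be the $K$-span of all monomials $x_1^{c_1}\cdots x_n^{c_n}t^k$ with $(c_1,\ldots,c_n)$ a $k$-cover of $\Delta$. The vertex cover algebra is the graded $S$-algebra $A(\Delta)=\bigoplus_{k\ge 0}A_k(\Delta)\subseteq S[t]$ (so $A_0(\Delta)=S$). It is called standard graded if it is generated over $S$ by $A_1(\Delta)$. *)

(* Defs.v *)
From HB Require Import structures.
From mathcomp Require Import all_boot all_order all_algebra.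
From mathcomp Require Import mpoly.

Set Implicit Arguments.
Unset Strict Implicit.
Unset Printing Implicit Defensive.

Import GRing.Theory.

Section SimplicialComplexes.

(* The vertex set {1, ..., n} is represented by 'I_n, and a complex by the
   set of all of its faces. *)
Variable n : nat.
Implicit Types (D E : {set {set 'I_n}}) (F G H : {set 'I_n}).

Definition facets D : {set {set 'I_n}} :=
  [set F | maxset (fun G => G \in D) F].

Definition simplicial_complex D : bool :=
  [&& [forall G in D, forall H : {set 'I_n}, (H \subset G) ==> (H \in D)],
      facets D != set0 & set0 \notin facets D].

Definition complex_of (A : {set {set 'I_n}}) : {set {set 'I_n}} :=
  [set G : {set 'I_n} | [exists F in A, G \subset F]].

(* Stronger than E \subset D: the facets of E have to be facets of D. *)
Definition subcomplex E D : bool :=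
  simplicial_complex E && (facets E \subset facets D).

Definition leaf D F : bool :=
  (F \in facets D) &&
  ((facets D == [set F]) ||
   [exists G in facets D, (G != F) &&
     [forall H in facets D, (H != F) ==> (H :&: F \subset G :&: F)]]).

Definition forest D : Prop :=
  forall E, subcomplex E D -> exists F, leaf E F.

Definition quasi_forest D : Prop :=
  exists s : seq {set 'I_n},
    [/\ uniq s, s =i facets D &
        forall i, 0 < i < size s ->
          leaf (complex_of [set F in take i.+1 s]) (nth set0 s i)].

Definition connected D : bool :=
  [forall F in facets D, forall G in facets D,
    connect [rel G1 G2 | [&& G1 \in facets D, G2 \in facets D
                           & G1 :&: G2 != set0]] F G].

Definition component D E : bool :=
  maxset (fun E' => subcomplex E' D && connected E') E.

Definition connected_codim1 D : bool :=
  connected D &&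
  [forall F in facets D, forall G in facets D,
    connect [rel G1 G2 | [&& G1 \in facets D, G2 \in facets D,
                             #|G1 :&: G2|.+1 == #|G1|
                           & #|G1 :&: G2|.+1 == #|G2|]] F G].

Definition codim1_face D F : Prop :=
  F \in D /\ exists e, (forall G, G \in facets D -> #|G| = e) /\ #|F|.+1 = e.

Definition kcover D (k : nat) (c : 'I_n -> nat) : bool :=
  [forall F in facets D, k <= \sum_(i in F) c i].

End SimplicialComplexes.

Section VertexCoverAlgebra.

(* S[t] is {poly {mpoly K[n]}}, with t = 'X. *)
Variables (K : fieldType) (n : nat) (D : {set {set 'I_n}}).

Local Open Scope ring_scope.

(* Finite K-linear combinations, each pair (a, c) in s being read as the
   term a x^c t^k. *)
Definition cover_piece (k : nat) (p : {poly {mpoly K[n]}}) : Prop :=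
  exists s : seq (K * 'X_{1..n}),
    (forall u, u \in s -> kcover D k u.2) /\
    p = \sum_(u <- s) (u.1 *: 'X_[u.2] : {mpoly K[n]}) *: 'X^k.

Definition vertex_cover_algebra (p : {poly {mpoly K[n]}}) : Prop :=
  exists (d : nat) (a : nat -> {poly {mpoly K[n]}}),
    (forall k, cover_piece k (a k)) /\ p = \sum_(k < d) a k.

End VertexCoverAlgebra.

Local Open Scope ring_scope.

Inductive subalgebra_generated (S : comNzRingType) (X : {poly S} -> Prop) :
    {poly S} -> Prop :=
| Subalg_gen p of X p : subalgebra_generated X p
| Subalg_const (a : S) : subalgebra_generated X a%:P
| Subalg_add p q of subalgebra_generated X p & subalgebra_generated X q :
    subalgebra_generated X (p + q)
| Subalg_mul p q of subalgebra_generated X p & subalgebra_generated X q :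
    subalgebra_generated X (p * q).

Definition standard_graded (K : fieldType) (n : nat) (D : {set {set 'I_n}}) :
    Prop :=
  forall p : {poly {mpoly K[n]}},
    vertex_cover_algebra D p <-> subalgebra_generated (cover_piece D 1%N) p.

(* Main.v *)
Require Import Defs.
From mathcomp Require Import all_boot all_order all_algebra.
From mathcomp Require Import mpoly.

Set Implicit Arguments.
Unset Strict Implicit.
Unset Printing Implicit Defensive.

(** The algebra A(D) and the subalgebra generated by its degree 1 part are both
    spanned over K by monomials, so standard gradedness is a statement about
    exponents: every k-cover dominates a sum of k 1-covers
    ([standard_gradedP]).

    For a forest such a sum is a colouring. Regard a k-cover as a vertex set
    with multiplicities and look for k colours such that every facet meets all
    of them. Any vertex set W has a 2-colouring in which every facet with at
    least two vertices in W meets both colours ([two_colouring], by induction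
    on the facets along leaves). If in a k-colouring some facet misses a colour
    p, then it repeats a colour q, and recolouring the union of these two
    classes by such a 2-colouring loses no incidence between facets and colours
    and gains one ([kempe_exchange]). Repeating this reaches the wanted
    colouring.

    For the converse, the facets of a component, joined when they share a face
    of codimension 1, form a tree: in a leaf order a new facet brings a new
    vertex and, as such a face lies in at most two facets, has at most one
    earlier neighbour. If a facet F has three neighbours G1, G2, G3, put weight 1
    on F, weight 0 on the other vertices of the Gi and large weight elsewhere.
    With k = |F| - 1 this is a k-cover, because no further facet is contained in
    the star of F ([facet_in_star]). Each Gi has weight exactly k, so in a
    decomposition every 1-cover has weight 1 on each F :&: Gi; this makes it
    vanish on the three vertices that F :&: Gi omit, which contradicts the
    tightness on the Gi ([splits_degree_le2]). So under standard gradedness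
    every facet has at most two neighbours, the tree is a path, and each vertex
    occupies an interval of that path ([path_like_part]). In a family of facets
    from such a path, the first one is a leaf whose branch is the second. *)

(** * Facets, leaves and components *)

Section Facets.

Variable n : nat.
Implicit Types (D E A B : {set {set 'I_n}}) (F G H : {set 'I_n}).

Definition antichain A : Prop :=
  forall F G, F \in A -> G \in A -> F \subset G -> F = G.

Lemma facet_face D F : F \in facets D -> F \in D.
Proof. by rewrite inE => /maxsetP[]. Qed.

Lemma face_sub_facet D F : F \in D -> exists2 G, G \in facets D & F \subset G.
Proof.
by move=> FD; have [G mG FG] := maxset_exists (P := mem D) FD; exists G; rewrite ?inE.
Qed.

Lemma facets_antichain D : antichain (facets D).
Proof.
move=> F G; rewrite inE => /maxsetP[_ maxF] /facet_face GD FG.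
by rewrite (maxF G GD FG).
Qed.

Lemma complex_ofP A G :
  reflect (exists2 F, F \in A & G \subset F) (G \in complex_of A).
Proof. by rewrite inE; apply: exists_inP. Qed.

Lemma facets_complex_of A : antichain A -> facets (complex_of A) = A.
Proof.
move=> acA; apply/setP=> F; rewrite inE; apply/maxsetP/idP => [[] | FA].
  move=> /complex_ofP[G GA FG] maxF.
  by rewrite -(maxF G) //; apply/complex_ofP; exists G.
split; first by apply/complex_ofP; exists F.
move=> G /complex_ofP[H HA GH] FG; apply/eqP; rewrite eqEsubset FG andbT.
by rewrite (acA F H) // (subset_trans FG).
Qed.

Lemma simplicial_complex_of A :
  antichain A -> A != set0 -> set0 \notin A -> simplicial_complex (complex_of A).
Proof.
move=> acA A0 nA; apply/and3P; rewrite facets_complex_of //; split=> //.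
apply/forall_inP=> G /complex_ofP[F FA GF]; apply/forallP=> H.
by apply/implyP=> HG; apply/complex_ofP; exists F => //; apply: subset_trans GF.
Qed.

Lemma subcomplex_of D A :
  simplicial_complex D -> A \subset facets D -> A != set0 ->
  subcomplex (complex_of A) D /\ facets (complex_of A) = A.
Proof.
move=> /and3P[_ _ nD] sAD A0.
have acA : antichain A.
  by move=> F G /(subsetP sAD) FA /(subsetP sAD) GA; apply: facets_antichain FA GA.
have fA := facets_complex_of acA; split=> //.
rewrite /subcomplex fA sAD andbT simplicial_complex_of //.
by apply: contra nD => /(subsetP sAD).
Qed.

(** Leaves only depend on the set of facets; this is the leaf condition for a
    bare family of sets, so that subcomplexes can be replaced by subfamilies. *)
Definition family_leaf A F : Prop :=
  F \in A /\ (A = [set F] \/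
    exists2 G, G \in A & G != F /\
      forall H, H \in A -> H != F -> H :&: F \subset G).

Definition every_subfamily_has_leaf A : Prop :=
  forall B, B \subset A -> B != set0 -> exists F, family_leaf B F.

Lemma leafP D F : leaf D F <-> family_leaf (facets D) F.
Proof.
split=> [/andP[FD leafF] | [FD leafF]].
  split=> //; case/orP: leafF => [/eqP-> | ]; first by left.
  case/exists_inP=> G GD /andP[GF /forall_inP HG]; right; exists G => //.
  split=> // H HD HF; have /implyP/(_ HF) := HG H HD.
  by move/subset_trans; apply; apply: subsetIl.
rewrite /leaf FD /=; case: leafF => [-> | [G GD [GF HG]]]; first by rewrite eqxx.
apply/orP; right; apply/exists_inP; exists G; rewrite ?GF //=.
apply/forall_inP=> H HD; apply/implyP=> HF.
by rewrite subsetI subsetIr andbT HG.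
Qed.

Lemma forestP D : simplicial_complex D ->
  (forest D <-> every_subfamily_has_leaf (facets D)).
Proof.
move=> scD; split=> [forD A sAD A0 | leafD E /andP[/and3P[_ E0 _] sED]].
  have [sub fA] := subcomplex_of scD sAD A0.
  by have [F /leafP] := forD _ sub; rewrite fA; exists F.
by have [F lF] := leafD _ sED E0; exists F; apply/leafP.
Qed.

(** The order is read backwards, the head of the list being the facet added
    last, so that a prefix of the facet order is a tail of the list. *)
Fixpoint leaf_order (t : seq {set 'I_n}) : Prop :=
  if t is L :: t' then
    (t' = [::] \/
     exists2 G, G \in t' & forall H, H \in t' -> H :&: L \subset G)
    /\ leaf_order t'
  else True.

Lemma quasi_forest_leaf_order D : quasi_forest D ->
  exists t, [/\ uniq t, t =i facets D & leaf_order t].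
Proof.
case=> s [us sD leafs]; exists (rev s); split; first by rewrite rev_uniq.
  by move=> F; rewrite mem_rev.
suff tk i : i <= size s -> leaf_order (rev (take i s)).
  by have := tk (size s) (leqnn _); rewrite take_size.
elim: i => [|i IHi] ltis; first by rewrite take0.
rewrite (take_nth set0) // rev_rcons /=; split; last exact/IHi/ltnW.
have [i0 | i_gt0] := posnP i; first by left; rewrite i0 take0.
right; move: (leafs i); rewrite i_gt0 ltis => /(_ isT)/leafP.
have sub F : F \in take i.+1 s -> F \in facets D.
  by move/mem_take; rewrite sD.
rewrite facets_complex_of; last first.
  by move=> F G; rewrite !inE => /sub FD /sub GD; apply: facets_antichain FD GD.
have uq : uniq (rcons (take i s) (nth set0 s i)).
  by rewrite -take_nth // take_uniq.
rewrite rcons_uniq in uq; case/andP: uq => notL _.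
rewrite (take_nth set0) //; set L := nth _ _ _ in notL *.
case=> _ [single | [G]].
  have s0i : nth set0 s 0 \in take i s.
    by rewrite -(nth_take _ i_gt0) mem_nth // size_takel ?(ltnW ltis).
  have : nth set0 s 0 \in [set L] by rewrite -single inE mem_rcons inE s0i orbT.
  by rewrite inE => /eqP eqL; rewrite -eqL s0i in notL.
rewrite inE mem_rcons inE => Gi [GL sG]; rewrite (negPf GL) /= in Gi.
exists G => [|H]; rewrite mem_rev // => Hi.
apply: sG; first by rewrite inE mem_rcons inE Hi orbT.
by apply: contraNneq notL => <-.
Qed.

Lemma face_component D F : simplicial_complex D -> F \in facets D ->
  exists2 E, component D E & F \in facets E.
Proof.
move=> scD FD.
have [sub fF] : subcomplex (complex_of [set F]) D /\ facets (complex_of [set F]) = [set F].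
  by apply: subcomplex_of; rewrite ?sub1set //; apply/set0Pn; exists F; rewrite inE.
have conF : connected (complex_of [set F]).
  apply/forall_inP=> G; rewrite fF inE => /eqP->.
  by apply/forall_inP=> H; rewrite inE => /eqP->; apply: connect0.
have [|E cE sFE] := maxset_exists
    (P := fun E => subcomplex E D && connected E) (C := complex_of [set F]).
  exact/andP.
exists E => //; case/maxsetP: cE => /andP[/andP[_ /subsetP sED] _] _.
have /face_sub_facet[G GE FG] : F \in E.
  by apply: (subsetP sFE); apply/complex_ofP; exists F; rewrite ?inE.
by rewrite (facets_antichain FD (sED _ GE) FG).
Qed.

(** Adding to a component a facet that meets it keeps it connected, so by
    maximality distinct components have disjoint facets. *)
Lemma component_meets D E F G : simplicial_complex D -> component D E ->
  F \in facets E -> G \in facets D -> G :&: F != set0 -> G \in facets E.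
Proof.
move=> scD /maxsetP[/andP[/andP[scE sED] conE] maxE] FE GD GF.
have [||sub fGE] := @subcomplex_of D (G |: facets E) scD.
- by rewrite subUset sub1set GD.
- by apply/set0Pn; exists G; rewrite !inE eqxx.
set E' := complex_of _ in sub fGE.
suff conE' : connected E'.
  rewrite -(maxE E') ?sub ?conE' //; first by rewrite fGE !inE eqxx.
  apply/subsetP=> H /face_sub_facet[H' H'E HH']; apply/complex_ofP.
  by exists H'; rewrite // in_setU1 H'E orbT.
set r := [rel G1 G2 | [&& G1 \in facets E', G2 \in facets E' & G1 :&: G2 != set0]].
have r_sym : connect_sym r.
  apply: sym_connect_sym => G1 G2 /=.
  by rewrite andbCA setIC.
have toF H : H \in facets E' -> connect r H F.
  rewrite fGE in_setU1 => /predU1P[-> | HE].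
    by apply: connect1; rewrite /= fGE !in_setU1 eqxx FE GF orbT.
  move/forall_inP/(_ H HE)/forall_inP/(_ F FE): conE.
  apply: connect_sub => G1 G2 /= /and3P[G1E G2E G12]; apply: connect1.
  by rewrite /= fGE !in_setU1 G1E G2E G12 !orbT.
apply/forall_inP=> G1 G1E; apply/forall_inP=> G2 G2E.
by apply: connect_trans (toF _ G1E) _; rewrite r_sym toF.
Qed.

End Facets.

(** * Colouring weighted forests *)

Section Colourings.

Variable n : nat.
Implicit Types (A B : {set {set 'I_n}}) (F G H W X : {set 'I_n}) (b c : 'I_n -> nat).

(** Remove a facet and colour for the others. If a leaf F has a vertex of W in
    no other facet, remove F and then give that vertex the colour opposite to
    another vertex of F. Otherwise the trace of F on W is contained in its branch
    G; then remove G instead, since G gets both colours as soon as F does. *)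
Lemma two_colouring A W : every_subfamily_has_leaf A ->
  exists X : {set 'I_n}, forall H, H \in A -> 1 < #|H :&: W| ->
    H :&: W :&: X != set0 /\ (H :&: W) :\: X != set0.
Proof.
move: {2}#|A| (leqnn #|A|) => m; elim: m A => [|m IHm] A leAm leafA.
  move: leAm; rewrite leqn0 cards_eq0 => /eqP->.
  by exists set0 => H; rewrite inE.
have [->|A0] := eqVneq A set0; first by exists set0 => H; rewrite inE.
have IH F : F \in A -> exists X : {set 'I_n}, forall H, H \in A -> H != F ->
    1 < #|H :&: W| -> H :&: W :&: X != set0 /\ (H :&: W) :\: X != set0.
  move=> FA; have [||X colX] := IHm (A :\ F).
  - by move: leAm; rewrite (cardsD1 F) FA.
  - move=> B sB; apply: leafA; apply: subset_trans sB _; exact: subsetDl.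
  by exists X => H HA HF; apply: colX; rewrite !inE HF.
have [F [FA leafF]] := leafA A (subxx _) A0.
have [smallF | largeF] := leqP #|F :&: W| 1.
  have [X colX] := IH F FA; exists X => H HA; have [->|HF] := eqVneq H F.
    by rewrite ltnNge smallF.
  exact: colX.
have [/existsP[x /andP[]] | noprivate] := boolP [exists x, (x \in F :&: W) &&
    [forall (H | (H \in A) && (H != F)), x \notin H]].
  move=> xFW /forall_inP xpriv.
  have {xpriv} xpriv H : H \in A -> H != F -> x \notin H.
    by move=> HA HF; apply: xpriv; rewrite HA.
  have [y] : exists y, y \in (F :&: W) :\ x.
    by apply/set0Pn; rewrite -card_gt0; move: largeF; rewrite (cardsD1 x) xFW.
  rewrite in_setD1 => /andP[yx yFW]; have [X colX] := IH F FA.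
  exists (if y \in X then X :\ x else x |: X) => H HA HW.
  have [->|HF] := eqVneq H F.
    case: ifP => yX; split; apply/set0Pn.
    - by exists y; rewrite in_setI yFW !inE yx.
    - by exists x; rewrite in_setD xFW !inE eqxx.
    - by exists x; rewrite in_setI xFW !inE eqxx.
    - by exists y; rewrite in_setD yFW !inE negb_or yx yX.
  have xH := xpriv H HA HF.
  have [/set0Pn[z zX] /set0Pn[w wX]] := colX H HA HF HW.
  move: zX wX; rewrite in_setI in_setD => /andP[zHW zX] /andP[wX wHW].
  have neq v : v \in H :&: W -> v != x.
    by rewrite in_setI => /andP[vH _]; apply: contraTneq vH => ->.
  split; apply/set0Pn; [exists z | exists w].
    by rewrite in_setI zHW; case: ifP; rewrite !inE zX ?orbT ?neq.
  by rewrite in_setD wHW; case: ifP; rewrite !inE (negPf wX) ?andbF ?orbF ?neq.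
case: leafF => [A1 | [G GA [GF sG]]].
  case/existsP: noprivate; have /set0Pn[x xFW] : F :&: W != set0.
    by rewrite -card_gt0 ltnW.
  exists x; rewrite xFW; apply/forall_inP=> H.
  by rewrite A1 inE; case: eqP.
have sFG : F :&: W \subset G :&: W.
  apply/subsetP=> x xFW; move: noprivate; rewrite negb_exists.
  move/forallP/(_ x); rewrite xFW negb_forall => /existsP[H].
  rewrite negb_imply negbK => /andP[/andP[HA HF] xH].
  move: xFW; rewrite !inE => /andP[xF ->]; rewrite andbT.
  by apply: (subsetP (sG H HA HF)); rewrite inE xH.
have [X colX] := IH G GA; exists X => H HA HW.
have [->|] := eqVneq H G; last by move=> HG; apply: colX.
have [|FX FnX] := colX F FA _ largeF; first by rewrite eq_sym.
split; first by apply: contraNneq FX => GX; rewrite -subset0 -GX setSI.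
by apply: contraNneq FnX => GX; rewrite -subset0 -GX setSD.
Qed.

Lemma weight_gt0 c F i : i \in F -> 0 < c i -> 0 < \sum_(i in F) c i.
Proof. by move=> iF ci; rewrite (bigD1 i) //= ltn_addr. Qed.

(** The weighted form of the 2-colouring: a vertex of weight at least 2 can
    serve both halves, and a facet of weight at least 2 without such a vertex has
    two vertices in the support of b, where the 2-colouring applies. *)
Lemma weight_bisection A b : every_subfamily_has_leaf A ->
  exists a : 'I_n -> nat, (forall i, a i <= b i) /\
    forall H, H \in A -> 1 < \sum_(i in H) b i ->
      0 < \sum_(i in H) a i /\ 0 < \sum_(i in H) (b i - a i).
Proof.
move=> leafA; pose W := [set i | 0 < b i].
have [X colX] := two_colouring W leafA.
exists (fun i => if 1 < b i then 1 else if i \in X then b i else 0).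
split=> [i | H HA bH]; first by case: ifP => [/ltnW|] //; case: ifP.
have [/existsP[i /andP[iH bi]] | light] := boolP [exists i, (i \in H) && (1 < b i)].
  by split; apply: (weight_gt0 iH); rewrite bi ?subn_gt0.
have {}light i : i \in H -> b i <= 1.
  by move=> iH; move: light; rewrite negb_exists => /forallP/(_ i); rewrite iH -leqNgt.
have /(colX H HA)[/set0Pn[i iX] /set0Pn[j jX]] : 1 < #|H :&: W|.
  apply: leq_trans bH _; rewrite -sum1_card big_mkcond [X in _ <= X]big_mkcond.
  apply: leq_sum => i _; rewrite !inE; case: ifP => //= iH.
  by case: posnP => [-> | _] //; apply: light.
move: iX jX; rewrite !inE => /andP[/andP[iH bi] iX] /and3P[jX jH bj].
split; [apply: (weight_gt0 iH) | apply: (weight_gt0 jH)].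
  by rewrite iX; case: ifP.
by rewrite (negPf jX); case: ifP; rewrite ?subn_gt0 ?subn0.
Qed.

(** A family of k weights is read as a k-colouring of a weighted vertex set; it
    consists of 1-covers exactly when its defect is 0. *)
Definition defect A k (a : 'I_k -> 'I_n -> nat) : nat :=
  \sum_(H in A) \sum_j (\sum_(i in H) a j i == 0).

(** A facet F missing the colour p repeats some colour q. Bisecting the union of
    the classes p and q gives both colours to F, and no facet loses: one whose
    weight in the union is 1 meets one of the two colours before and after, and
    one of weight at least 2 meets both after. *)
Lemma kempe_exchange A k c (a : 'I_k -> 'I_n -> nat) :
  every_subfamily_has_leaf A ->
  (forall H, H \in A -> k <= \sum_(i in H) c i) ->
  (forall i, \sum_j a j i = c i) ->
  (exists p F, F \in A /\ \sum_(i in F) a p i = 0) ->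
  exists a' : 'I_k -> 'I_n -> nat,
    (forall i, \sum_j a' j i = c i) /\ defect A a' < defect A a.
Proof.
move=> leafA coverc suma [p [F [FA aF0]]].
(* By pigeonhole, as F has weight at least k and misses a colour. *)
have [/existsP[q aq] | few] := boolP [exists q, 1 < \sum_(i in F) a q i]; last first.
  have := coverc F FA; rewrite leqNgt => /negP[].
  under eq_bigr do rewrite -suma.
  rewrite exchange_big /= (bigD1 p) //= aF0 add0n.
  apply: (@leq_ltn_trans (\sum_(j | j != p) 1)).
    apply: leq_sum => j _; rewrite leqNgt; apply: contra few => aj.
    by apply/existsP; exists j.
  by rewrite sum1_card cardC1 card_ord ltn_predL; apply: leq_ltn_trans (ltn_ord p).
have qp : q != p by apply: contraTneq aq => ->; rewrite aF0.
pose b i := a p i + a q i.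
have [d [leda bis]] := weight_bisection b leafA.
pose a' j := if j == p then d else if j == q then fun i => b i - d i else a j.
have a'p : a' p = d by rewrite /a' eqxx.
have a'q : a' q = fun i => b i - d i by rewrite /a' (negPf qp) eqxx.
have a'E j : (j != p) && (j != q) -> a' j = a j.
  by case/andP => /negPf jp /negPf jq; rewrite /a' jp jq.
have split_sum (f : 'I_k -> nat) :
    \sum_j f j = f p + (f q + \sum_(j | (j != p) && (j != q)) f j).
  by rewrite (bigD1 p) //= (bigD1 q).
exists a'; split=> [i | ].
  rewrite -suma !split_sum a'p a'q !addnA subnKC ?leda //; congr (_ + _).
  by apply: eq_bigr => j /a'E->.
have wb H : \sum_(i in H) a p i + \sum_(i in H) a q i = \sum_(i in H) b i.
  by rewrite -big_split.
have wd H : \sum_(i in H) d i + \sum_(i in H) (b i - d i) = \sum_(i in H) b i.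
  by rewrite -big_split; apply: eq_bigr => i _; rewrite /= subnKC.
have rest H : \sum_(j | (j != p) && (j != q)) (\sum_(i in H) a' j i == 0) =
              \sum_(j | (j != p) && (j != q)) (\sum_(i in H) a j i == 0).
  by apply: eq_bigr => j /a'E->.
have le H : H \in A -> \sum_j (\sum_(i in H) a' j i == 0) <=
                       \sum_j (\sum_(i in H) a j i == 0).
  move=> HA; rewrite !split_sum rest !addnA leq_add2r a'p a'q.
  have := bis H HA; move: (wb H) (wd H).
  move: (\sum_(i in H) b i) (\sum_(i in H) d i) (\sum_(i in H) (b i - d i)).
  move: (\sum_(i in H) a p i) (\sum_(i in H) a q i) => x y w u v.
  have [w1 _ _ /(_ isT)[u0 v0] | w1 wx wu _] := ltnP 1 w.
    by rewrite !eqn0Ngt u0 v0.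
  by case: w w1 wx wu => [|[|//]] _; case: x => [|[|x]] //; case: y => [|[|y]] //;
    case: u => [|[|u]] //; case: v => [|[|v]].
rewrite /defect (bigD1 F) //= [X in _ < X](bigD1 F) //= -addSn leq_add //; last first.
  by apply: leq_sum => H /andP[HA _]; apply: le.
rewrite !split_sum rest !addnA ltn_add2r a'p a'q aF0.
have [|dF eF] := bis F FA; first by rewrite -wb aF0.
by rewrite !eqn0Ngt dF eF (ltnW aq).
Qed.

Lemma leafy_family_colouring A k c : every_subfamily_has_leaf A ->
  (forall H, H \in A -> k <= \sum_(i in H) c i) ->
  exists a : 'I_k -> 'I_n -> nat,
    (forall j H, H \in A -> 0 < \sum_(i in H) a j i) /\
    (forall i, \sum_j a j i <= c i).
Proof.
case: k => [|k] leafA coverc.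
  by exists (fun _ => c); split=> [[]|i] //; rewrite big_ord0.
suff improve m (a : 'I_k.+1 -> 'I_n -> nat) : defect A a <= m ->
    (forall i, \sum_j a j i = c i) ->
    exists a' : 'I_k.+1 -> 'I_n -> nat,
      (forall j H, H \in A -> 0 < \sum_(i in H) a' j i) /\
      (forall i, \sum_j a' j i = c i).
  have [|a [cov suma]] := improve _ (fun j i => if j == ord0 then c i else 0) (leqnn _).
    by move=> i; rewrite (bigD1 ord0) //= big1 ?addn0 // => j /negPf->.
  by exists a; split=> // i; rewrite suma.
elim: m a => [|m IHm] a lem suma.
all: have [/existsP[p /exists_inP[F FA /eqP aF]] | good] :=
  boolP [exists p, exists F in A, \sum_(i in F) a p i == 0].
- have [|a' [_]] := kempe_exchange leafA coverc suma; first by exists p, F.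
  by move: lem; rewrite leqn0 => /eqP->.
- exists a; split=> // j H HA; rewrite lt0n; apply: contra good => aj.
  by apply/existsP; exists j; apply/exists_inP; exists H.
- have [|a' [suma' lta]] := kempe_exchange leafA coverc suma; first by exists p, F.
  by apply: (IHm a'); rewrite // -ltnS (leq_trans lta).
- exists a; split=> // j H HA; rewrite lt0n; apply: contra good => aj.
  by apply/existsP; exists j; apply/exists_inP; exists H.
Qed.

End Colourings.

(** * Standard gradedness in terms of exponents *)

Section Algebra.

Import GRing.Theory.
Variables (K : fieldType) (n : nat) (D : {set {set 'I_n}}).
Implicit Types (p q : {poly {mpoly K[n]}}) (k : nat) (m : 'X_{1..n}).
Implicit Types (S : nat -> 'X_{1..n} -> Prop).

Lemma kcoverP k (c : 'I_n -> nat) :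
  kcover D k c <-> forall F, F \in facets D -> k <= \sum_(i in F) c i.
Proof. by split=> [/forall_inP | ?]; last exact/forall_inP. Qed.

(** Domination rather than equality: the remainder is the exponent of a
    coefficient in S. *)
Definition splits k (c : 'I_n -> nat) : Prop :=
  exists s : seq 'X_{1..n},
    [/\ size s = k, forall a, a \in s -> kcover D 1 a
      & forall i, \sum_(a <- s) a i <= c i].

Lemma splits_kcover k c : splits k c -> kcover D k c.
Proof.
case=> s [<- cov le]; apply/kcoverP=> F FD.
apply: (@leq_trans (\sum_(i in F) \sum_(a <- s) a i)); last exact: leq_sum.
rewrite exchange_big /= -sum1_size big_seq [X in _ <= X]big_seq.
by apply: leq_sum => a /cov/kcoverP; apply.
Qed.

Lemma splits_add k l m m' : splits k m -> splits l m' -> splits (k + l) (m + m')%MM.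
Proof.
case=> s [<- covs les] [s' [<- covs' les']]; exists (s ++ s').
split=> [|a|i]; first by rewrite size_cat.
  by rewrite mem_cat => /orP[/covs | /covs'].
by rewrite big_cat mnmDE leq_add.
Qed.

Local Open Scope ring_scope.

(** Both algebras are of this form, S k m standing for the presence of the
    monomial x^m t^k in the spanning set. *)
Definition supported S p : Prop := forall k m, p`_k@_m != 0 -> S k m.

Lemma supportedD S p q : supported S p -> supported S q -> supported S (p + q).
Proof.
move=> Sp Sq k m; rewrite coefD mcoeffD.
have [p0 | /Sp //] := eqVneq p`_k@_m 0.
by rewrite p0 add0r => /Sq.
Qed.

Lemma supported0 S : supported S 0.
Proof. by move=> k m; rewrite coef0 mcoeff0 eqxx. Qed.

Lemma supportedM S p q :
  (forall k l m m', S k m -> S l m' -> S (k + l)%N (m + m')%MM) ->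
  supported S p -> supported S q -> supported S (p * q).
Proof.
move=> SD Sp Sq k m; rewrite coefM -mcoeff_msupp => /msupp_sum_le.
case/flatten_mapP=> i _ /msuppM_le/allpairsP[[m1 m2] /= [m1p m2q ->]].
rewrite -[X in S X _](@subnKC i) -1?ltnS //.
by apply: SD; [apply: Sp | apply: Sq]; rewrite -mcoeff_msupp.
Qed.

Lemma supported_term S (a : K) k m : S k m ->
  supported S ((a *: 'X_[m] : {mpoly K[n]}) *: 'X^k).
Proof.
move=> Skm j m'; rewrite coefZ coefXn.
have [->|_] := eqVneq j k; last by rewrite mulr0 mcoeff0 eqxx.
rewrite mulr1 mcoeffZ mcoeffX; have [<- //|_] := eqVneq m m'.
by rewrite mulr0 eqxx.
Qed.

Lemma poly_terms p :
  p = \sum_(k < size p) \sum_(m <- msupp p`_k)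
        ((p`_k)@_m *: 'X_[m] : {mpoly K[n]}) *: 'X^k.
Proof.
rewrite -{1}[p]coefK poly_def; apply: eq_bigr => k _.
by rewrite {1}[p`_k]mpolyE scaler_suml.
Qed.

Lemma vertex_cover_algebraP p :
  vertex_cover_algebra D p <-> supported (fun k m => kcover D k m) p.
Proof.
split=> [[d [a [pa ->]]] | Sp].
  apply: big_ind; [exact: supported0 | exact: supportedD | move=> k _].
  have [s [cov ->]] := pa k; rewrite big_seq.
  apply: big_ind; [exact: supported0 | exact: supportedD | move=> u us].
  by apply: supported_term; apply: cov.
exists (size p), (fun k => \sum_(m <- msupp p`_k)
        ((p`_k)@_m *: 'X_[m] : {mpoly K[n]}) *: 'X^k).
split=> [k|]; last exact: poly_terms.
exists [seq (p`_k@_m, m) | m <- msupp p`_k]; split; last by rewrite /= big_map.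
by move=> _ /mapP[m mp ->]; apply: Sp; rewrite -mcoeff_msupp.
Qed.

Lemma generated_splits k m (a : K) : splits k m ->
  subalgebra_generated (cover_piece D 1) ((a *: 'X_[m] : {mpoly K[n]}) *: 'X^k).
Proof.
case=> s [<- cov le]; have {le} -> : m = ((m - \sum_(b <- s) b) + \sum_(b <- s) b)%MM.
  by apply/mnmP=> i; rewrite mnmDE mnmBE mnm_sumE subnK.
rewrite mpolyXD scalerAl -scalerA -mul_polyC; apply: Subalg_mul.
  exact: Subalg_const.
elim: s cov => [|b s IHs] cov.
  by rewrite big_nil mpolyX0 scale1r expr0 -polyC1; apply: Subalg_const.
rewrite big_cons mpolyXD /= exprS -scalerA scalerAr scalerAl; apply: Subalg_mul.
  apply: Subalg_gen; exists [:: (1, b)]; split=> [u|].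
    by rewrite inE => /eqP->; apply: cov; rewrite inE eqxx.
  by rewrite big_seq1 scale1r expr1.
by apply: IHs => c cs; apply: cov; rewrite inE cs orbT.
Qed.

Lemma subalgebra_generatedP p :
  subalgebra_generated (cover_piece D 1) p <-> supported splits p.
Proof.
split=> [|Sp].
  elim=> {p} [p [s [cov ->]] | a | p q _ Sp _ Sq | p q _ Sp _ Sq].
  - rewrite big_seq; apply: big_ind; [exact: supported0 | exact: supportedD | ].
    move=> u us; apply: supported_term; exists [:: u.2].
    split=> // [b | i]; last by rewrite big_seq1.
    by rewrite inE => /eqP->; apply: cov.
  - move=> k m; rewrite coefC; case: k => [_ | k]; last by rewrite mcoeff0 eqxx.
    by exists [::]; split=> // i; rewrite big_nil.
  - exact: supportedD.
  - by apply: supportedM => // k l m m'; apply: splits_add.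
rewrite (poly_terms p).
have gen0 : subalgebra_generated (cover_piece D 1) (0 : {poly {mpoly K[n]}}).
  by rewrite -polyC0; apply: Subalg_const.
apply: big_ind; [exact: gen0 | exact: Subalg_add | move=> k _].
rewrite big_seq; apply: big_ind; [exact: gen0 | exact: Subalg_add | move=> m mp].
by apply: generated_splits; apply: Sp; rewrite -mcoeff_msupp.
Qed.

Lemma standard_gradedP :
  standard_graded K D <-> forall k m, kcover D k m -> splits k m.
Proof.
split=> [std k m cov | spl p].
  have /std/subalgebra_generatedP : vertex_cover_algebra D ((1 *: 'X_[m] : {mpoly K[n]}) *: 'X^k).
    by apply/vertex_cover_algebraP; apply: supported_term.
  apply; rewrite coefZ coefXn eqxx mulr1 scale1r mcoeffX eqxx; exact: oner_neq0.
split=> [/vertex_cover_algebraP Sp | /subalgebra_generatedP Sp].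
  by apply/subalgebra_generatedP => k m /Sp/spl.
by apply/vertex_cover_algebraP => k m /Sp/splits_kcover.
Qed.

End Algebra.

Lemma forest_splits n (D : {set {set 'I_n}}) k (c : 'I_n -> nat) :
  every_subfamily_has_leaf (facets D) -> kcover D k c -> splits D k c.
Proof.
move=> leafD /kcoverP cov.
have [a [cova lea]] := leafy_family_colouring leafD cov.
exists [seq [multinom a j i | i < n] | j <- enum 'I_k]; split.
- by rewrite size_map -cardE card_ord.
- move=> _ /mapP[j _ ->]; apply/kcoverP=> F FD.
  by under eq_bigr do rewrite mnmE; apply: cova.
- by move=> i; rewrite big_map big_enum; under eq_bigr do rewrite mnmE.
Qed.

(** * Components connected in codimension 1 *)

Lemma connect_map (T : finType) (e e' : rel T) (f : T -> T) :
  (forall x y, e x y -> connect e' (f x) (f y)) ->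
  forall x y, connect e x y -> connect e' (f x) (f y).
Proof.
move=> he x y /connectP[p]; elim: p x => [|z p IHp] x /=; first by move=> _ ->.
by case/andP=> /he exz pz ly; apply: connect_trans exz (IHp z pz ly).
Qed.

Section Adjacency.

Variable n : nat.
Implicit Types (F G H L P R : {set 'I_n}) (B : {set {set 'I_n}}) (t : seq {set 'I_n}).

(** The step relation of connectedness in codimension 1. *)
Definition adjacent F G : bool :=
  (#|F :&: G|.+1 == #|F|) && (#|F :&: G|.+1 == #|G|).

Lemma adjacentC F G : adjacent F G = adjacent G F.
Proof. by rewrite /adjacent setIC andbC. Qed.

Lemma adjacent_neq F G : adjacent F G -> F != G.
Proof. by apply: contraTneq => ->; rewrite /adjacent setIid eqn_leq ltnn. Qed.

Definition adjacent_in B := [rel F G | [&& F \in B, G \in B & adjacent F G]].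

Definition ridge_connected B : Prop :=
  forall F G, F \in B -> G \in B -> connect (adjacent_in B) F G.

Lemma ridge_connected_card B F G : ridge_connected B ->
  F \in B -> G \in B -> #|F| = #|G|.
Proof.
move=> conB FB GB; have /connectP[p] := conB F G FB GB.
elim: p F {FB} => [|H p IHp] F /=; first by move=> _ ->.
case/andP=> /and3P[_ _ /andP[/eqP<- /eqP eH]] pH lH.
by rewrite -(IHp H pH lH).
Qed.

End Adjacency.

Section Component.

Variables (n : nat) (A C : {set {set 'I_n}}).
Implicit Types (F G H L P R : {set 'I_n}) (N : {set {set 'I_n}}) (t p : seq {set 'I_n}).

Hypothesis acA : antichain A.
Hypothesis sCA : C \subset A.
(* The form in which it will be used that a face of codimension 1 lies in at
   most two facets: F, G and H would be three facets around F :&: H. *)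
Hypothesis thinC : forall F G H, F \in C -> G \in C -> H \in C ->
  adjacent F H -> adjacent G H -> F :&: H = G :&: H -> F = G.

Let inA F : F \in C -> F \in A. Proof. exact: (subsetP sCA). Qed.

(** The intersection of a leaf L with its branch G is a proper subset of L
    containing the codimension 1 face P :&: L, hence equal to it. *)
Lemma adjacent_branch L t P H : uniq (L :: t) -> {subset L :: t <= A} ->
  leaf_order (L :: t) -> P \in t -> adjacent P L -> H \in t -> H :&: L \subset P.
Proof.
case/andP=> Lt _ tA [[-> // | [G Gt branchG]] _] Pt /andP[_ /eqP PL] Ht.
have PLG : P :&: L = G :&: L.
  apply/eqP; rewrite eqEcard subsetI branchG // subsetIr /= -ltnS PL.
  apply: proper_card; rewrite properEneq subsetIr andbT.
  apply: contraNneq Lt => GL; rewrite (@acA L G) //; last by rewrite -GL subsetIl.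
    by rewrite tA ?mem_head.
  by rewrite tA // inE Gt orbT.
apply: subset_trans (subsetIl P L); rewrite PLG.
by rewrite subsetI branchG // subsetIr.
Qed.

(** By [adjacent_branch] two such neighbours contain the same face of L. *)
Lemma adjacent_leaf_unique L t P P' : uniq (L :: t) -> {subset L :: t <= A} ->
  leaf_order (L :: t) -> L \in C -> P \in C -> P' \in C -> P \in t -> P' \in t ->
  adjacent P L -> adjacent P' L -> P = P'.
Proof.
move=> ut tA ot LC PC P'C Pt P't PL P'L; apply: (thinC PC P'C LC) => //.
have sub := adjacent_branch ut tA ot.
by apply/eqP; rewrite eqEsubset !subsetI !subsetIr !andbT !sub.
Qed.

Definition part t : {set {set 'I_n}} := [set F in C | F \in t].

(** A leaf has at most one neighbour, so folding it onto that neighbour maps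
    walks to walks and connectedness survives its removal. *)
Lemma ridge_connected_drop_leaf L t : uniq (L :: t) -> {subset L :: t <= A} ->
  leaf_order (L :: t) -> ridge_connected (part (L :: t)) ->
  ridge_connected (part t).
Proof.
move=> ut tA ot conL F G; have /andP[Lt _] := ut.
rewrite !inE => /andP[FC Ft] /andP[GC Gt].
(* The default F is harmless: if L has no neighbour, then no walk passes L. *)
pose Q := odflt F [pick P in part t | (L \in C) && adjacent P L].
have QP P : P \in part t -> L \in C -> adjacent P L -> P = Q.
  rewrite /Q => Pt LC PL; case: pickP => [P' | /(_ P)] /=.
    move: Pt; rewrite !inE => /andP[PC Pt] /andP[/andP[P'C P't] /andP[_ P'L]].
    exact: (adjacent_leaf_unique ut tA ot).
  by rewrite Pt LC PL.
pose f X := if X == L then Q else X.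
have fE X : X \in t -> f X = X.
  by move=> Xt; rewrite /f; case: eqP => // XL; rewrite -XL Xt in Lt.
rewrite -(fE F) // -(fE G) //.
apply: (connect_map (e := adjacent_in (part (L :: t)))); last first.
  by apply: conL; rewrite !inE ?FC ?GC ?Ft ?Gt orbT.
move=> X Y /and3P[]; rewrite inE in_cons => /andP[XC XL].
rewrite inE in_cons => /andP[YC YL] XY; rewrite /f.
case: (eqVneq X L) XL => [XL _ | _ /= Xt]; case: (eqVneq Y L) YL => [YL _ | _ /= Yt].
- exact: connect0.
- by rewrite -(QP Y) ?connect0 // ?inE ?YC -?XL // adjacentC.
- by rewrite -(QP X) ?connect0 // ?inE ?XC -?YL.
- by apply: connect1; rewrite /= !inE XC Xt YC Yt.
Qed.

(** Around a facet the complex looks like a tree. Going down the leaf order, the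
    last facet L has a vertex of its own, so it lies in the star's vertex set
    only if it belongs to the star. When L is an outer facet of the star, the
    part of any other facet inside L lies in the centre, so L can be dropped
    from the star. When L is the centre, the star has at most one outer facet P,
    and the same argument with P leaves P alone. *)
Lemma facet_in_star F0 N t G : uniq t -> {subset t <= A} -> leaf_order t ->
  F0 \in C -> N \subset C -> (forall H, H \in N -> adjacent F0 H) ->
  F0 \in t -> {subset N <= t} ->
  G \in t -> G \subset F0 :|: cover N -> G \in F0 |: N.
Proof.
elim: t N => // L t IHt N ut tA ot FC sNC adjN Ft Nt Gt sG.
have /andP[Lt ut'] := ut; have [leafL ot'] := ot.
have tA' : {subset t <= A} by move=> H Ht; apply: tA; rewrite inE Ht orbT.
have [eGL | GL] := eqVneq G L.
  case: leafL => [t0 | [B Bt branchB]].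
    by move: Gt Ft; rewrite t0 !inE => /eqP-> /eqP->; rewrite eqxx.
  have [v vL vB] : exists2 v, v \in L & v \notin B.
    apply/subsetPn; apply: contraNN Lt => LB; rewrite (@acA L B) ?tA ?mem_head //.
    by rewrite inE Bt orbT.
  have vt H : H \in L :: t -> v \in H -> H = L.
    rewrite inE => /predU1P[// | Ht vH]; case/negP: vB.
    by apply: (subsetP (branchB H Ht)); rewrite inE vH.
  have : v \in F0 :|: cover N by apply: (subsetP sG); rewrite eGL.
  rewrite in_setU in_setU1 eGL => /orP[/(vt F0 Ft)-> | ]; first by rewrite eqxx.
  by case/bigcupP=> M MN vM; rewrite -(vt M (Nt M MN) vM) MN orbT.
have {}Gt : G \in t by move: Gt; rewrite inE (negPf GL).
have [LF | LF] := eqVneq L F0.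
  have NL M : M \in N -> M \in t.
    move=> MN; have := Nt M MN; rewrite inE => /predU1P[ML|//].
    by have := adjacent_neq (adjN M MN); rewrite ML LF eqxx.
  have [N0 | [P PN]] := set_0Vmem N.
    move: sG; rewrite N0 /cover big_set0 setU0 => sG.
    by rewrite (acA (tA' G Gt) (inA FC) sG) !inE eqxx.
  have PL : adjacent P L by rewrite adjacentC LF adjN.
  suff GP : G \subset P.
    by rewrite (acA (tA' G Gt) (tA' P (NL P PN)) GP) in_setU1 PN orbT.
  apply/subsetP=> x xG; have := subsetP sG x xG; rewrite inE => /orP[xF|].
    apply: (subsetP (adjacent_branch ut tA ot (NL P PN) PL Gt)).
    by rewrite inE xG LF.
  case/bigcupP=> M MN; rewrite (@adjacent_leaf_unique L t M P) ?NL //.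
  - by rewrite LF.
  - exact: (subsetP sNC).
  - exact: (subsetP sNC).
  - by rewrite adjacentC LF adjN.
have {}Ft : F0 \in t by move: Ft; rewrite inE eq_sym (negPf LF).
suff : G \in F0 |: (N :\ L) by rewrite !inE => /predU1P[->|/andP[_ ->]]; rewrite ?eqxx ?orbT.
apply: IHt => //.
- by apply: subset_trans sNC; apply: subsetDl.
- by move=> H; rewrite inE => /andP[_ /adjN].
- by move=> H; rewrite !inE => /andP[HL /Nt]; rewrite inE (negPf HL).
apply/subsetP=> x xG; have := subsetP sG x xG; rewrite !inE => /orP[-> //|].
case/bigcupP=> M MN xM; have [ML|ML] := eqVneq M L; last first.
  by apply/orP; right; apply/bigcupP; exists M; rewrite // !inE ML.
apply/orP; left; rewrite ML in xM MN.
apply: (subsetP (adjacent_branch ut tA ot Ft (adjN L MN) Gt)).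
by rewrite inE xG.
Qed.

(** The second condition says that the positions of the facets containing a
    given vertex form an interval. *)
Definition path_like p : Prop :=
  (forall i, i.+1 < size p -> adjacent (nth set0 p i) (nth set0 p i.+1)) /\
  (forall i j k, i <= j -> j <= k -> k < size p ->
     nth set0 p i :&: nth set0 p k \subset nth set0 p j).

Lemma path_like_rev p : path_like p -> path_like (rev p).
Proof.
case=> adjp convp; split=> [i | i j k ij jk]; rewrite size_rev.
  move=> ltip; rewrite !nth_rev // ?(ltnW ltip) // adjacentC.
  have e : size p - i.+1 = (size p - i.+2).+1 by rewrite subnSK.
  by rewrite e; apply: adjp; rewrite -e ltn_subrL; case: (size p) ltip.
move=> kp; have jp := leq_ltn_trans jk kp; have ip := leq_ltn_trans ij jp.
rewrite !nth_rev // setIC; apply: convp; rewrite ?leq_sub2l //.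
by rewrite ltn_subrL; case: (size p) ip.
Qed.

Lemma path_like_cons L p : path_like p -> p != [::] -> adjacent (head set0 p) L ->
  (forall H, H \in p -> H :&: L \subset head set0 p) -> path_like (L :: p).
Proof.
case=> adjp convp p0 adjL branch; have p_gt0 : 0 < size p by rewrite lt0n size_eq0.
split=> [[|i] /= ip | [|i] [|j] [|k] //= ij jk kp].
- by rewrite nth0 adjacentC.
- exact: adjp.
- exact: subsetIl.
- exact: subsetIl.
- apply: subset_trans (convp 0 j k (leq0n j) jk kp).
  by rewrite subsetI subsetIr setIC andbT nth0 branch ?mem_nth.
- exact: convp.
Qed.

Hypothesis degC : forall F, F \in C -> #|[set G in C | adjacent F G]| <= 2.

(** In a leaf order a new facet L is adjacent to a unique earlier facet P, its
    branch. By the degree bound P is at an end of the list built so far, and L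
    extends the list beyond that end. *)
Lemma path_like_part t : uniq t -> {subset t <= A} -> leaf_order t ->
  ridge_connected (part t) ->
  exists p, [/\ uniq p, p =i part t & path_like p].
Proof.
elim: t => [|L t IHt] ut tA ot cont.
  by exists [::]; split=> // F; rewrite !inE andbF.
have [_ ot'] := ot; have /andP[Lt ut'] := ut.
have tA' : {subset t <= A} by move=> H Ht; apply: tA; rewrite inE Ht orbT.
have [p [up pt lp]] := IHt ut' tA' ot' (ridge_connected_drop_leaf ut tA ot cont).
have [LC | LC] := boolP (L \in C); last first.
  exists p; split=> // F; rewrite pt !inE; case: eqP => [-> | //].
  by rewrite (negPf LC).
have partL F : F \in L :: p = (F \in part (L :: t)).
  by rewrite inE pt !inE; case: eqP => [-> | //]; rewrite LC.
have [p0 | [Q Qp]] : p = [::] \/ exists Q, Q \in p.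
  by case: (p) => [|Q q]; [left | right; exists Q; rewrite mem_head].
  exists [:: L]; split=> // [F|]; first by rewrite -partL p0.
  by split=> [[|i] | [|i] [|j] [|k]] //= _ _ _; apply: subsetIl.
have [P [Pp PL]] : exists P, P \in p /\ adjacent P L.
  have /connectP[[|P q]] : connect (adjacent_in (part (L :: t))) L Q.
  - by apply: cont; rewrite -partL inE ?eqxx ?Qp ?orbT.
  - by move=> _ /= QL; move: Qp; rewrite QL pt !inE (negPf Lt) andbF.
  case/andP=> /and3P[_ PB LP] _ _; exists P; split; last by rewrite adjacentC.
  by move: PB; rewrite -partL inE eq_sym (negPf (adjacent_neq LP)).
have Lp : L \notin p by rewrite pt inE (negPf Lt) andbF.
have inpt H : H \in p -> H \in t by rewrite pt inE => /andP[].
have inpC H : H \in p -> H \in C by rewrite pt inE => /andP[].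
have branch H : H \in p -> H :&: L \subset P.
  by move/inpt; apply: (adjacent_branch ut tA ot (inpt P Pp) PL).
have extend p' : uniq p' -> p' =i p -> path_like p' -> head set0 p' = P ->
    exists p, [/\ uniq p, p =i part (L :: t) & path_like p].
  move=> up' eqp lp' hp'; exists (L :: p'); split.
  - by rewrite /= eqp Lp.
  - by move=> F; rewrite -partL !inE eqp.
  - apply: path_like_cons; rewrite ?hp' //.
      by apply/eqP=> p'0; move: Pp; rewrite -eqp p'0.
    by move=> H; rewrite eqp; apply: branch.
have [[|i] ip Pi] : exists2 i, i < size p & nth set0 p i = P.
  by exists (index P p); rewrite ?index_mem ?nth_index.
  by apply: (extend p); rewrite // -nth0.
have [lasti | ltip] := eqVneq i.+2 (size p).
  apply: (extend (rev p)); rewrite ?rev_uniq //; first exact: mem_rev.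
    exact: path_like_rev.
  by rewrite -nth0 nth_rev ?(leq_trans _ ip) // -lasti subn1.
have {}ltip : i.+2 < size p by rewrite ltn_neqAle ltip.
have [adjp _] := lp; have PC := inpC P Pp.
(* An inner P would be adjacent to L and to both its neighbours in the list. *)
suff : 2 < #|[set G in C | adjacent P G]| by rewrite ltnNge degC.
apply/card_gt2P; exists (nth set0 p i), (nth set0 p i.+2), L.
have ip' := ltnW ip.
have [ai ai2] := (mem_nth set0 ip', mem_nth set0 ltip).
split; split.
- by rewrite inE inpC // -Pi adjacentC adjp.
- by rewrite inE inpC // -Pi adjp.
- by rewrite inE LC.
- by rewrite nth_uniq // eqn_leq ltnNge leqnSn !andbF.
- by apply: contraNneq Lp => <-.
- by apply: contraNneq Lp => ->.
Qed.

End Component.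

(** * A facet with three neighbours *)

Lemma sum_size_tight (T : eqType) (s : seq T) (f : T -> nat) :
  (forall a, a \in s -> 0 < f a) -> \sum_(a <- s) f a <= size s ->
  forall a, a \in s -> f a = 1.
Proof.
elim: s => // b s IHs pos; rewrite big_cons /= => le a.
have pos_s c : c \in s -> 0 < f c by move=> cs; rewrite pos // inE cs orbT.
have ge_s : size s <= \sum_(c <- s) f c.
  by rewrite -sum1_size big_seq [X in _ <= X]big_seq; apply: leq_sum.
have b_gt0 : 0 < f b by rewrite pos ?mem_head.
have fb : f b = 1.
  apply/eqP; rewrite eqn_leq b_gt0 andbT -(leq_add2r (size s)).
  by apply: leq_trans le; rewrite leq_add2l.
rewrite inE => /predU1P[-> // | /(IHs pos_s)]; apply.
by rewrite -(leq_add2l 1) -{1}fb.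
Qed.

Lemma adjacent_setD n (F G : {set 'I_n}) : adjacent F G ->
  exists2 x, F = x |: (F :&: G) & x \notin G.
Proof.
case/andP=> /eqP FG _; have /cards1P[x eD] : #|F :\: G| == 1.
  by rewrite -(eqn_add2l #|F :&: G|) cardsID addn1 FG.
exists x; first by rewrite -eD setUC setID.
by have := set11 x; rewrite -eD inE => /andP[].
Qed.

(** Let k = |F| - 1 and let c have weight 1 on F, weight 0 on the remaining
    vertices of three neighbours G1, G2, G3 and weight k elsewhere. Each Gi has
    weight exactly k, so each of the k 1-covers a in a decomposition has weight
    exactly 1 on F :&: Gi, which is F minus a vertex xi. Hence
    a(x1) = a(x2) = a(x3) = a(F) - 1, and both x1 and x2 lie in F :&: G3 of
    weight 1, so a(x1) = 0. But then the k 1-covers have to share the k - 1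
    units of weight on F :&: G2 outside x1. *)
Lemma splits_degree_le2 n (D C : {set {set 'I_n}}) :
  quasi_forest D -> C \subset facets D ->
  (forall F G H, F \in C -> G \in C -> H \in C ->
     adjacent F H -> adjacent G H -> F :&: H = G :&: H -> F = G) ->
  (forall k (m : 'X_{1..n}), kcover D k m -> splits D k m) ->
  forall F, F \in C -> #|[set G in C | adjacent F G]| <= 2.
Proof.
move=> /quasi_forest_leaf_order[t [ut tD ot]] sCD thinC spl F FC.
rewrite leqNgt; apply/negP=> /card_gt2P[G1 [G2 [G3 [[]]]]].
rewrite !inE => /andP[C1 a1] /andP[C2 a2] /andP[C3 a3] [d12 d23 d31].
pose N := [set G1; G2; G3]; pose k := #|F|.-1.
have NP H : H \in N -> H \in C /\ adjacent F H.
  by rewrite !inE => /orP[/orP[]|] /eqP->.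
have cardFN H : H \in N -> #|F :&: H| = k.
  by case/NP=> _ /andP[/eqP FH _]; rewrite /k -FH.
have [G1N G2N G3N] : [/\ G1 \in N, G2 \in N & G3 \in N] by rewrite !inE !eqxx ?orbT.
pose c := [multinom if i \in F then 1 else if i \in cover N then 0 else k | i < n].
have cF i : i \in F -> c i = 1 by move=> iF; rewrite mnmE iF.
have cN i : i \notin F -> i \in cover N -> c i = 0.
  by move=> /negPf iF iN; rewrite mnmE iF iN.
have cover_c : kcover D k c.
  apply/kcoverP=> G GD; have [sG | /subsetPn[x xG]] := boolP (G \subset F :|: cover N).
    have : G \in F |: N.
      have tA : {subset t <= facets D} by move=> H; rewrite tD.
      apply: (facet_in_star (@facets_antichain n D) sCD thinC ut tA ot) => //.
      - by apply/subsetP=> H /NP[].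
      - by move=> H /NP[].
      - by rewrite tD (subsetP sCD).
      - by move=> H /NP[HC _]; rewrite tD (subsetP sCD).
      - by rewrite tD.
    rewrite in_setU1 => GFN; apply: (@leq_trans #|F :&: G|).
      case/predU1P: GFN => [-> | /cardFN-> //].
      by rewrite setIid leq_pred.
    rewrite -sum1_card big_mkcond [X in _ <= X]big_mkcond; apply: leq_sum => i _.
    by rewrite inE andbC; case: (i \in G) => //; case: ifP => // /cF->.
  rewrite inE negb_or => /andP[/negPf xF /negPf xN].
  by rewrite (bigD1 x) //= mnmE xF xN leq_addr.
have [s [sz covs les]] := spl k c cover_c.
have a0 a i : a \in s -> i \notin F -> i \in cover N -> a i = 0.
  move=> sa iF iN; apply/eqP; rewrite -leqn0 -(cN i iF iN) (leq_trans _ (les i)) //.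
  by rewrite (perm_big _ (perm_to_rem sa)) big_cons leq_addr.
have sumF (f : 'I_n -> nat) H : H \in N ->
    (forall i, i \notin F -> i \in cover N -> f i = 0) ->
    \sum_(i in H) f i = \sum_(i in F :&: H) f i.
  move=> HN f0; rewrite (big_setID F) /= setIC [X in _ + X]big1 ?addn0 // => i.
  by rewrite inE => /andP[iF iH]; apply: f0 => //; apply/bigcupP; exists H.
have cov1 a H : a \in s -> H \in N -> 0 < \sum_(i in F :&: H) a i.
  move=> sa HN; rewrite -sumF //; last by move=> i; apply: a0.
  by have /kcoverP := covs a sa; apply; apply: (subsetP sCD); case: (NP H HN).
have tight a H : a \in s -> H \in N -> \sum_(i in F :&: H) a i = 1.
  move=> sa HN; move: a sa; apply: sum_size_tight => [a sa|]; first exact: cov1.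
  rewrite exchange_big sz -(cardFN H HN) -sum1_card; apply: leq_sum => i.
  by rewrite inE => /andP[/cF<- _].
have missing H : H \in N -> exists x,
    [/\ x \in F, x \notin H & forall a, a \in s -> \sum_(i in F) a i = (a x).+1].
  move=> HN; have [_ /adjacent_setD[x eF xH]] := NP H HN.
  exists x; split=> // [|a sa]; first by rewrite eF setU11.
  by rewrite eF big_setU1 ?inE ?(negPf xH) ?andbF //= tight // addn1.
have distinct H H' x : H \in N -> H' \in N -> H != H' ->
    x \in F -> x \notin H -> x \in H'.
  move=> HN H'N HH' xF xH; apply: contraNT HH' => xH'; apply/eqP.
  have [[HC aH] [H'C aH']] := (NP H HN, NP H' H'N).
  apply: (thinC _ _ F); rewrite // 1?adjacentC // ![_ :&: F]setIC.
  have sub K : K \in N -> x \notin K -> F :&: K = F :\ x.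
    move=> KN xK; apply/eqP; rewrite eqEcard cardFN // /k (cardsD1 x F) xF leqnn andbT.
    apply/subsetP=> y; rewrite !inE => /andP[-> yK]; rewrite andbT.
    by apply: contraNneq xK => <-.
  by rewrite !sub.
have [x1 [x1F x1G1 s1]] := missing G1 G1N.
have [x2 [x2F x2G2 s2]] := missing G2 G2N.
have x1G2 : x1 \in G2 by apply: (distinct G1).
have x1G3 : x1 \in G3 by apply: (distinct G1); rewrite // eq_sym.
have x2G3 : x2 \in G3 by apply: (distinct G2).
have x12 : x2 != x1 by apply: contraNneq x2G2 => ->.
have ax1 a : a \in s -> a x1 = 0.
  move=> sa; have := tight a G3 sa G3N.
  rewrite (bigD1 x1) /=; last by rewrite inE x1F.
  rewrite (bigD1 x2) /=; last by rewrite inE x2F x2G3.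
  have [e12] : (a x1).+1 = (a x2).+1 by rewrite -s1 // -s2.
  by rewrite -e12; case: (a x1) => // u; rewrite addnA addSn addnS.
have : size s <= \sum_(a <- s) \sum_(i in F :&: G2) a i.
  by rewrite -sum1_size big_seq [X in _ <= X]big_seq; apply: leq_sum => a sa; rewrite tight.
rewrite exchange_big /= (bigD1 x1) /=; last by rewrite inE x1F.
rewrite big_seq big1 ?add0n // => le.
have : k <= \sum_(i in (F :&: G2) :\ x1) 1.
  rewrite -sz (leq_trans le) // big_mkcond [X in _ <= X]big_mkcond.
  apply: leq_sum => i _; rewrite !inE andbC.
  by case: ifP => // /andP[_ /andP[iF _]]; rewrite -(cF i iF).
rewrite sum1_card -(cardFN G2 G2N) (cardsD1 x1 (F :&: G2)) inE x1F x1G2.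
by rewrite ltnn.
Qed.

(** The members of B inside the component C occur along the list; the first of
    them is a leaf with the second as branch, by the interval property. Members
    of B outside C do not meet it. *)
Lemma path_like_leaf n (A C B : {set {set 'I_n}}) p F : uniq p -> p =i C -> path_like p ->
  (forall G H, G \in A -> H \in C -> G :&: H != set0 -> G \in C) ->
  B \subset A -> F \in B -> F \in C -> exists F', family_leaf B F'.
Proof.
move=> up pC [_ convp] clC sBA FB FC.
have F0P : F \in B :&: C by rewrite inE FB.
case: (arg_minnP (fun G => index G p) F0P) => L /setIP[LB LC] minL.
exists L; split=> //.
have disj G : G \in B -> G \notin C -> G :&: L = set0.
  move=> GB GC; apply/eqP; apply: contraNT GC; exact: clC (subsetP sBA _ GB) LC.
have [B1 | [G1]] := set_0Vmem (B :\ L).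
  by left; apply/eqP; rewrite eqEsubset sub1set LB andbT -setD_eq0 B1.
rewrite !inE => /andP[G1L G1B]; right.
have [BC1 | [G2 G2P]] := set_0Vmem ((B :&: C) :\ L).
  exists G1 => //; split=> // H HB HL; rewrite disj ?sub0set //.
  apply/negP=> HC; have : H \in (B :&: C) :\ L by rewrite !inE HL HB HC.
  by rewrite BC1 inE.
case: (arg_minnP (fun G => index G p) G2P) => G /setD1P[GL /setIP[GB GC]] minG.
exists G => //; split=> // H HB HL; have [HC | HC] := boolP (H \in C); last first.
  by rewrite disj ?sub0set.
rewrite setIC; have := convp (index L p) (index G p) (index H p).
rewrite !nth_index ?index_mem ?pC //; apply=> //.
  by apply: minL; apply/setIP.
by apply: minG; apply/setD1P; split=> //; apply/setIP.
Qed.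

(** * The equivalence *)

Theorem theorem4p2 (K : fieldType) (n : nat) (D : {set {set 'I_n}}) :
  simplicial_complex D ->
  quasi_forest D ->
  (forall E : {set {set 'I_n}}, component D E -> connected_codim1 E) ->
  (forall E : {set {set 'I_n}}, component D E ->
     forall F : {set 'I_n}, codim1_face E F ->
       #|[set G in facets E | F \subset G]| <= 2) ->
  (forest D <-> standard_graded K D).
Proof.
move=> scD qfD conD thinD; split=> [/(forestP scD) leafD | /standard_gradedP spl].
  by apply/standard_gradedP => k m; apply: forest_splits.
apply/(forestP scD) => B sBD /set0Pn[F FB].
have [E cE FE] := face_component scD (subsetP sBD F FB).
have /maxsetP[/andP[/andP[scE sED] _] _] := cE.
have ridgeE : ridge_connected (facets E).
  move=> G H GE HE; have /andP[_ /forall_inP con] := conD E cE.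
  by have /forall_inP := con G GE; apply.
have thinE G G' H : G \in facets E -> G' \in facets E -> H \in facets E ->
    adjacent G H -> adjacent G' H -> G :&: H = G' :&: H -> G = G'.
  move=> GE G'E HE GH G'H eqI; apply: contraTeq (thinD E cE (G :&: H) _) => [GG' | ].
    rewrite -ltnNge; apply/card_gt2P; exists G, G', H; split; split=> //.
    - by rewrite inE GE subsetIl.
    - by rewrite inE G'E eqI subsetIl.
    - by rewrite inE HE subsetIr.
    - exact: adjacent_neq.
    - by rewrite eq_sym adjacent_neq.
  split; last first.
    exists #|H|; split; last by case/andP: GH => _ /eqP.
    by move=> G1 G1E; apply: ridge_connected_card ridgeE G1E HE.
  have /and3P[/forall_inP/(_ H (facet_face HE))/forallP/(_ (G :&: H))/implyP closed _ _] := scE.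
  by apply: closed; apply: subsetIr.
have degE := splits_degree_le2 qfD sED thinE spl.
have [t [ut tD ot]] := quasi_forest_leaf_order qfD.
have tA : {subset t <= facets D} by move=> H; rewrite tD.
have partE : part (facets E) t = facets E.
  by apply/setP=> H; rewrite inE tD andb_idr //; apply: (subsetP sED).
have [|p [up pE lp]] := path_like_part (@facets_antichain n D) thinE degE ut tA ot.
  by rewrite partE.
rewrite partE in pE; apply: (path_like_leaf up pE lp _ sBD FB FE) => G H GD HE.
exact: component_meets scD cE HE GD.
Qed.
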